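(* A graph $G$ is a Sterboul--Deming graph with $C(G)=\emptyset$ if and only if $V(G)=\mathrm{Flower}(G)$.
   Context: All graphs are finite, undirected and simple. For a graph $G$, the Gallai--Edmonds sets are: $D(G)$, the set of vertices missed by some maximum matching of $G$; $A(G)$, the set of vertices not in $D(G)$ that have a neighbor in $D(G)$; and $C(G)=V(G)\setminus(D(G)\cup A(G))$. Let $M$ be a matching of $G$. A path (or walk) is $M$-alternating if, of any two consecutive edges, exactly one belongs to $M$; an $mm$-$M$-path is an $M$-alternating path whose first and last edges are in $M$. An $M$-blossom is an odd cycle of length $2k+1$ with exactly $k$ edges in $M$; its base is the unique vertex of the cycle not covered by those $k$ edges. An $M$-Tflower consists of an $M$-blossom together with an $M$-stem, i.e. an $M$-alternating path of even length (possibly zero) connecting the base of the blossom to a vertex not saturated by $M$ in $G$, where the base is the only common vertex of the blossom and the stem. An $M$-Tposy consists of two $M$-blossoms joined by an $mm$-$M$-path whose endpoints are the bases of the two blossoms, such that no internal vertex of the path lies in the blossoms and the intersection of the two blossoms is either empty or an $mm$-$M$-path. $\mathrm{Flower}(G)$ is the set of vertices of $G$ that belong to an $M$-Tflower for some maximum matching $M$ of $G$. Define $SD(G)$ as the set of vertices $v$ of $G$ for which there is a maximum matching $M$ of $G$ such that $v$ lies in an $M$-Tflower or an $M$-Tposy, and $KE(G)=V(G)\setminus SD(G)$. A graph $G$ is a Sterboul--Deming graph if $KE(G)=\emptyset$. *)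

(* Defs.v *)
From HB Require Import structures.
From mathcomp Require Import all_boot.
Set Implicit Arguments.
Unset Strict Implicit.
Unset Printing Implicit Defensive.

Record sgraph := SGraph {
  vertex :> finType;
  adj : rel vertex;
  adj_sym : symmetric adj;
  adj_irrefl : irreflexive adj
}.

Section Defs.
Variable G : sgraph.
Implicit Types (M N : {set {set G}}) (x y b v : G) (p q s c : seq G).

(* An edge is the unordered pair of its endpoints. *)
Definition edges : {set {set G}} :=
  [set [set x; y] | x in [set: G], y in [set: G] & adj x y].

Definition matching M : bool := (M \subset edges) && trivIset M.

Definition max_matching M : bool :=
  matching M && [forall N : {set {set G}}, matching N ==> (#|N| <= #|M|)].

Definition saturated M v : bool := v \in cover M.

(* Gallai--Edmonds sets *)
Definition GE_D : {set G} :=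
  [set v | [exists M : {set {set G}}, max_matching M && ~~ saturated M v]].

Definition GE_A : {set G} :=
  [set v | (v \notin GE_D) && [exists u in GE_D, adj v u]].

Definition GE_C : {set G} := ~: (GE_D :|: GE_A).

(* A path is given, as in path.v, by its first vertex x and the sequence p of *)
(* the remaining ones: it ends at last x p and its length is size p.          *)
Definition gpath x p : bool := path (@adj G) x p && uniq (x :: p).

Definition path_edges x p : seq {set G} :=
  pairmap (fun u v => [set u; v]) x p.

Definition altpath M x p : bool :=
  gpath x p &&
  sorted (fun f g : {set G} => (f \in M) (+) (g \in M)) (path_edges x p).

Definition mm_path M x p : bool :=
  [&& altpath M x p, 0 < size p,
      head set0 (path_edges x p) \in M & last set0 (path_edges x p) \in M].

Definition gcycle c : bool := [&& 2 < size c, cycle (@adj G) c & uniq c].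

Definition cycle_edges c : seq {set G} := [seq [set x; next c x] | x <- c].

Definition blossom M c : bool :=
  [&& gcycle c, odd (size c) &
      count (fun f => f \in M) (cycle_edges c) == (size c)./2].

Definition base M c b : bool :=
  (b \in c) && all (fun f : {set G} => (f \in M) ==> (b \notin f)) (cycle_edges c).

Definition stem M b s : bool :=
  [&& altpath M b s, ~~ odd (size s) & ~~ saturated M (last b s)].

(* Blossom c with base b, and stem b :: s. *)
Definition Tflower M c b s : bool :=
  [&& blossom M c, base M c b, stem M b s &
      [set v in c] :&: [set v in b :: s] == [set b]].

(* Every path or cycle is duplicate-free, so it has at most #|G| vertices:    *)
(* quantifying over {bseq #|G| of G}, here and below, loses nothing.          *)
(* The intersection is that of subgraphs: common vertices and common edges.   *)
Definition meet_mm_path M c1 c2 : bool :=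
  [exists y : G, exists q : {bseq #|G| of G},
    [&& mm_path M y q,
        [set v in y :: q] == [set v in c1] :&: [set v in c2] &
        [set f in path_edges y q]
          == [set f in cycle_edges c1] :&: [set f in cycle_edges c2]]].

(* Blossoms c1 and c2 with bases b and last b p, joined by the path b :: p;   *)
(* the internal vertices of that path are behead (belast b p).                *)
Definition Tposy M c1 c2 b p : bool :=
  [&& blossom M c1, blossom M c2, mm_path M b p,
      base M c1 b, base M c2 (last b p),
      all (fun v => (v \notin c1) && (v \notin c2)) (behead (belast b p)) &
      ([set v in c1] :&: [set v in c2] == set0) || meet_mm_path M c1 c2].

Definition in_Tflower M v : bool :=
  [exists c : {bseq #|G| of G}, exists b : G, exists s : {bseq #|G| of G},
    Tflower M c b s && ((v \in (c : seq G)) || (v \in b :: s))].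

Definition in_Tposy M v : bool :=
  [exists c1 : {bseq #|G| of G}, exists c2 : {bseq #|G| of G},
   exists b : G, exists p : {bseq #|G| of G},
    Tposy M c1 c2 b p &&
    [|| v \in (c1 : seq G), v \in (c2 : seq G) | v \in b :: p]].

Definition Flower : {set G} :=
  [set v | [exists M : {set {set G}}, max_matching M && in_Tflower M v]].

Definition SD : {set G} :=
  [set v | [exists M : {set {set G}},
             max_matching M && (in_Tflower M v || in_Tposy M v)]].

Definition KE : {set G} := ~: SD.

Definition Sterboul_Deming : Prop := KE = set0.

End Defs.

Arguments GE_D G : clear implicits.
Arguments GE_A G : clear implicits.
Arguments GE_C G : clear implicits.
Arguments edges G : clear implicits.
Arguments Flower G : clear implicits.
Arguments SD G : clear implicits.
Arguments KE G : clear implicits.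
Arguments Sterboul_Deming G : clear implicits.

(* Main.v *)
(* Call a vertex reachable if, for some maximum matching, it lies on an even
   alternating path to an unsaturated vertex r that has a neighbour in D.
   Such an r is the base of a blossom contained in D, and the path meets it in r
   only once it has been cut short so that none of its vertices at odd positions
   is in D: reachable vertices are in Flower.
   Reachability is preserved by the edges between A and D (exchange arguments),
   and a vertex of D with a neighbour in D is reachable.  So when C is empty,
   the unreachable vertices of D have only unreachable vertices of A as
   neighbours, and each unreachable vertex of A is matched to an unreachable
   vertex of D.  An alternating walk around a Tposy through an unreachable vertex
   thus alternates between A and D.  Followed around a blossom it puts the base
   in A, but followed along the joining path it puts the base of one of the two
   blossoms in D. *)
Require Import Defs.
From mathcomp Require Import all_boot.
From mathcomp Require Import zify.

Section Stems.
Set Implicit Arguments.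
Unset Strict Implicit.
Unset Printing Implicit Defensive.

Variable G : sgraph.
Implicit Types (M N : {set {set G}}) (a b c d r u v w x y z : G).
Implicit Types (p q s t : seq (G * G)) (f e : {set G}).

(** * Edges, matchings and saturated vertices *)

Lemma edgesP f :
  reflect (exists x y, adj x y /\ f = [set x; y]) (f \in edges G).
Proof.
apply: (iffP imset2P) => [[x y _]|[x [y [xy ->]]]].
  by rewrite inE => /andP[_ xy] ->; exists x, y.
by exists x y => //; rewrite !inE.
Qed.

Lemma adj_neq x y : adj x y -> x != y.
Proof. by apply: contraTneq => ->; rewrite adj_irrefl. Qed.

Lemma set2_inj x y z : [set x; y] = [set x; z] -> y = z.
Proof.
move=> E.
have /set2P yP : y \in [set x; z] by rewrite -E !inE eqxx orbT.
have /set2P zP : z \in [set x; y] by rewrite E !inE eqxx orbT.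
by case: yP zP => [->|//] [->|->].
Qed.

Lemma matching_sub M N : N \subset M -> matching M -> matching N.
Proof.
move=> NM /andP[sM tM]; rewrite /matching (subset_trans NM) //=.
exact: trivIsetS tM.
Qed.

Section Matching.
Variables (M : {set {set G}}) (mM : matching M).

Lemma matching_adj x y : [set x; y] \in M -> adj x y.
Proof.
case/andP: mM => /subsetP sM _ /sM /edgesP[a [b [ab E]]].
have xab : x \in [set a; b] by rewrite -E !inE eqxx.
case/set2P: xab E => ->; first by move/set2_inj->.
by rewrite [RHS]setUC adj_sym in ab * => /set2_inj->; rewrite // adj_sym.
Qed.

Lemma matching_inj x y z : [set x; y] \in M -> [set x; z] \in M -> y = z.
Proof.
move=> xy xz; apply: (@set2_inj x); apply/eqP; apply: contraT => ne.
case/andP: mM => _ /trivIsetP/(_ _ _ xy xz ne)/pred0P/(_ x).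
by rewrite /= !inE eqxx.
Qed.

Lemma saturatedP v : reflect (exists x, [set v; x] \in M) (saturated M v).
Proof.
apply: (iffP bigcupP) => [[f fM vf]|[x vx]]; last first.
  by exists [set v; x] => //; rewrite !inE eqxx.
case/andP: mM => /subsetP/(_ _ fM)/edgesP[x [y [xy E]]] _.
move: vf fM; rewrite E => /set2P[] ->; first by exists y.
by rewrite setUC; exists x.
Qed.

Lemma matching_add f : f \in edges G -> (forall v, v \in f -> ~~ saturated M v) ->
  matching (f |: M) /\ f \notin M.
Proof.
move=> fe unsat.
have [x xf] : exists x, x \in f.
  by case/edgesP: fe => x [y [_ ->]]; exists x; rewrite !inE eqxx.
have fM : f \notin M.
  by apply: contra (unsat _ xf) => fM; apply/bigcupP; exists f.
split=> //; case/andP: mM => sM tM; apply/andP; split.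
  by rewrite subUset sub1set fe.
apply/trivIsetP => A B /setU1P AM /setU1P BM neq.
have main C : C \in M -> [disjoint f & C].
  move=> CM; apply/pred0P => z /=; apply/negP => /andP[/unsat zu zC].
  by case/negP: zu; apply/bigcupP; exists C.
case: AM BM neq => [->|AM] [->|BM].
- by rewrite eqxx.
- by move=> _; exact: main.
- by move=> _; rewrite disjoint_sym; exact: main.
- exact: (trivIsetP tM).
Qed.

End Matching.

(** * Maximum matchings and the exchange of one edge *)

Lemma max_matchingW M : max_matching M -> matching M.
Proof. by case/andP. Qed.

Lemma leq_max_matching M N : max_matching M -> matching N -> #|N| <= #|M|.
Proof. by case/andP=> _ /forallP/(_ N)/implyP. Qed.

Lemma card_max M N : max_matching M -> matching N -> #|M| <= #|N| ->
  max_matching N.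
Proof.
move=> maxM mN le; rewrite /max_matching mN; apply/forallP => N'.
by apply/implyP => mN'; apply: leq_trans le; apply: leq_max_matching.
Qed.

Lemma max_no_edge M a b : max_matching M -> adj a b ->
  ~~ saturated M a -> ~~ saturated M b -> False.
Proof.
move=> maxM ab ua ub; have mM := max_matchingW maxM.
have [||m2 n2] := @matching_add M mM [set a; b].
- by apply/edgesP; exists a, b.
- by move=> v /set2P[] ->.
by have := leq_max_matching maxM m2; rewrite cardsU1 n2 add1n ltnn.
Qed.

(** Dropping [ab] frees [a], and [c] is already free, so [ac] can replace it at equal size. Since
    only these two edges change status, paths that avoid them survive. *)
Lemma exchange M a b c : max_matching M -> [set a; b] \in M ->
  ~~ saturated M c -> adj a c ->
  let M' := [set a; c] |: (M :\ [set a; b]) in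
  [/\ max_matching M', ~~ saturated M' b &
      forall f, f != [set a; b] -> f != [set a; c] -> (f \in M') = (f \in M)].
Proof.
move=> maxM abM uc ac M'; have mM := max_matchingW maxM.
have sub : M :\ [set a; b] \subset M by exact: subsetDl.
have mD := matching_sub sub mM.
have uD v z : [set v; z] \in M -> (v \in [set a; b]) -> ~~ saturated (M :\ [set a; b]) v.
  move=> vz vab; apply/(saturatedP mD) => -[w]; rewrite !inE => /andP[/negP nvw vw].
  case: nvw; move: vab vz vw; case/set2P=> ->.
    by move=> _ /(matching_inj mM abM) ->.
  by move: abM; rewrite setUC => abM _ /(matching_inj mM abM) ->.
have uDc : ~~ saturated (M :\ [set a; b]) c.
  apply: contra uc => /(saturatedP mD)[w cw]; apply/(saturatedP mM).
  by exists w; apply: (subsetP sub).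
have uDa : ~~ saturated (M :\ [set a; b]) a by apply: (uD _ b) => //; rewrite !inE eqxx.
have baM : [set b; a] \in M by rewrite setUC.
have uDb : ~~ saturated (M :\ [set a; b]) b by apply: (uD _ a) => //; rewrite !inE eqxx orbT.
have [||mM' nM'] := @matching_add _ mD [set a; c].
- by apply/edgesP; exists a, c.
- by move=> v /set2P[] ->.
have bc : b != c.
  by apply: contraNneq uc => <-; apply/(saturatedP mM); exists a.
have ba : b != a by rewrite (adj_neq (matching_adj mM _)).
split.
- apply: (card_max maxM) => //; rewrite cardsU1 nM' /=.
  by rewrite (cardsD1 [set a; b] M) abM.
- apply/(saturatedP mM') => -[z]; rewrite in_setU1 => /orP[/eqP|bz].
    by move/setP/(_ b); rewrite !inE eqxx /= (negbTE bc) (negbTE ba).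
  by case/negP: uDb; apply/(saturatedP mD); exists z.
- by move=> f n1 n2; rewrite !inE (negbTE n2) n1.
Qed.

(** * Alternating stems, switching, and membership in [GE_D] *)

Lemma GE_DP v : reflect (exists2 M, max_matching M & ~~ saturated M v) (v \in GE_D G).
Proof.
rewrite inE; apply: (iffP existsP) => [[M /andP[]]|[M h1 h2]].
  by exists M.
by exists M; rewrite h1.
Qed.

(* The list [(x1, y1); (x2, y2); ...] stands for the path w, x1, y1, x2, y2, ...
   whose edges w x1, y1 x2, ... belong to [M]; such paths have even length. *)
Fixpoint verts t : seq G := if t is (x, y) :: t' then x :: y :: verts t' else [::].

Definition tip w t := last w (unzip2 t).

Fixpoint apath M w t : bool :=
  if t is (x, y) :: t' then [&& [set w; x] \in M, adj x y & apath M y t'] else true.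

Definition astem M w t : bool :=
  [&& apath M w t, uniq (w :: verts t) & ~~ saturated M (tip w t)].

Lemma verts_cat s t : verts (s ++ t) = verts s ++ verts t.
Proof. by elim: s => [|[x y] s IH] //=; rewrite IH. Qed.

Lemma size_verts t : size (verts t) = (size t).*2.
Proof. by elim: t => [|[x y] t IH] //=; rewrite IH. Qed.

Lemma last_verts w t : last w (verts t) = tip w t.
Proof. by elim: t w => [|[x y] t IH] w //=; rewrite IH. Qed.

Lemma tip_cat w s t : tip w (s ++ t) = tip (tip w s) t.
Proof. by rewrite /tip /unzip2 map_cat last_cat. Qed.

Lemma tip_mem w t : tip w t \in w :: verts t.
Proof. by rewrite -last_verts mem_last. Qed.

Lemma mem_verts t v : (v \in verts t) = (v \in unzip1 t) || (v \in unzip2 t).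
Proof.
elim: t => [|[x y] t IH] //=; rewrite !inE IH.
by case: (v == x); case: (v == y); rewrite ?orbT.
Qed.

Lemma apath_cat M w s t : apath M w (s ++ t) = apath M w s && apath M (tip w s) t.
Proof. by elim: s w => [|[x y] s IH] w //=; rewrite IH !andbA. Qed.

Lemma apath_eq M N w t :
  (forall f, f \in M -> f \subset [set v in w :: verts t] -> f \in N) ->
  apath M w t -> apath N w t.
Proof.
elim: t w => [|[x y] t IH] w //= sub /and3P[wx xy yt].
rewrite xy IH ?andbT //=.
  apply: sub => //; apply/subsetP => z; rewrite !inE.
  by case/orP=> ->; rewrite ?orbT.
move=> f fM /subsetP fs; apply: sub => //; apply/subsetP => z /fs.
by rewrite !inE => ->; rewrite !orbT.
Qed.

Lemma astem_drop M w s t : astem M w (s ++ t) -> astem M (tip w s) t.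
Proof.
elim: s w => [|[x y] s IH] w //= /and3P[/and3P[_ _ p]].
by rewrite /= => /and3P[_ _ un] ut; apply: IH; apply/and3P.
Qed.

(** The pairs are regrouped along the reversed path: the steps [y x], outside the matching before a
    switch, become the matching edges after it. *)
Fixpoint rev_stem w t : seq (G * G) :=
  if t is (x, y) :: t' then rcons (rev_stem y t') (x, w) else [::].

Lemma verts_rev_stem w t : tip w t :: verts (rev_stem w t) = rev (w :: verts t).
Proof.
elim: t w => [|[x y] t IH] w //=.
rewrite -cats1 verts_cat /= -cat_cons IH.
by rewrite (rev_cons w) (rev_cons x) -!cats1 -catA.
Qed.

Lemma tip_rev_stem w t : tip (tip w t) (rev_stem w t) = w.
Proof. by rewrite -[LHS]last_verts -(last_cons w) verts_rev_stem rev_cons last_rcons. Qed.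

Lemma subset_set2 x y (l : seq G) :
  ([set x; y] \subset [set v in l]) = (x \in l) && (y \in l).
Proof. by rewrite subUset !sub1set !inE. Qed.

(** This is the symmetric difference with the stem, done as exchanges from the tip back to [w], each
    moving the unsaturated vertex two steps. An edge with an end off the stem is not affected. *)
Lemma switch M w t : max_matching M -> astem M w t ->
  exists M', [/\ max_matching M', ~~ saturated M' w,
    apath M' (tip w t) (rev_stem w t) &
    forall f, ~~ (f \subset [set v in w :: verts t]) -> (f \in M') = (f \in M)].
Proof.
move=> maxM; elim: t w => [|[x y] t IH] w stw.
  by exists M; split=> //; case/and3P: stw.
have [M1 [max1 u1 p1 e1]] := IH y (@astem_drop M w [:: (x, y)] t stw).
have [/= /and3P[wx xy _] /and3P[wn xn _] _] := and3P stw.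
have wn' : w \notin y :: verts t.
  by apply: contra wn; rewrite !(inE, in_cons) => ->; rewrite orbT.
have xwM1 : [set x; w] \in M1.
  by rewrite setUC e1 // subset_set2 (negbTE wn').
have [max2 u2 e2] := exchange max1 xwM1 u1 xy.
exists ([set x; y] |: (M1 :\ [set x; w])); split=> //.
  rewrite [tip _ _](_ : _ = tip y t) //= -cats1 apath_cat tip_rev_stem /=.
  rewrite [[set y; x]]setUC setU11 (matching_adj (max_matchingW max1)) // !andbT.
  apply: apath_eq p1 => f fM1; rewrite verts_rev_stem => fs.
  rewrite e2 //; apply: contraTneq fs => ->; rewrite subset_set2 !mem_rev.
    by rewrite (negbTE wn') andbF.
  by rewrite (negbTE xn).
move=> f nf.
have sub : ([set v in y :: verts t] \subset [set v in [:: w, x, y & verts t]]).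
  by apply/subsetP => z; rewrite !inE => ->; rewrite !orbT.
rewrite e2 ?e1 //.
- by apply: contra nf => /subset_trans; apply.
- by apply: contraNneq nf => ->; rewrite subset_set2 !inE !eqxx !orbT.
- by apply: contraNneq nf => ->; rewrite subset_set2 !inE !eqxx !orbT.
Qed.

Lemma astem_D M w t : max_matching M -> astem M w t -> w \in GE_D G.
Proof. by move=> maxM /(switch maxM)[M' [? ? _ _]]; apply/GE_DP; exists M'. Qed.

Lemma astem_even_D M w t v : max_matching M -> astem M w t -> v \in w :: unzip2 t ->
  v \in GE_D G.
Proof.
move=> maxM; elim: t w => [|[x y] t IH] w st; rewrite in_cons.
  by rewrite in_nil orbF => /eqP->; exact: astem_D st.
case/orP=> [/eqP->|]; first exact: astem_D st.
exact/IH/(@astem_drop M w [:: (x, y)]).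
Qed.

Lemma astem_odd M w t v : matching M -> astem M w t -> v \in unzip1 t ->
  exists2 z, z \in w :: unzip2 t & [set v; z] \in M.
Proof.
move=> mM; elim: t w => [|[x y] t IH] w //= st.
have [/= /and3P[wx _ _] _ _] := and3P st.
case/predU1P=> [->|vt]; first by exists w; rewrite ?inE ?eqxx // setUC.
have [z zt vz] := IH y (@astem_drop M w [:: (x, y)] t st) vt.
by exists z => //; rewrite inE zt orbT.
Qed.

Lemma astem_even M w t v : astem M w t -> v \in w :: unzip2 t ->
  v = tip w t \/ exists2 z, z \in unzip1 t & [set v; z] \in M.
Proof.
elim: t w => [|[x y] t IH] w st; first by rewrite inE => /eqP; left.
have [/= /and3P[wx _ _] _ _] := and3P st.
case/predU1P=> [->|vt]; first by right; exists x; rewrite // inE eqxx.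
have [->|[z zt vz]] := IH y (@astem_drop M w [:: (x, y)] t st) vt; first by left.
by right; exists z; rewrite // inE zt orbT.
Qed.

Lemma mem_verts_cons w t v :
  (v \in w :: verts t) = (v \in w :: unzip2 t) || (v \in unzip1 t).
Proof. by rewrite !inE mem_verts -orbA [(v \in unzip2 t) || _]orbC. Qed.

(** Even and odd positions are mates of each other and the tip is unsaturated, so a stem is closed
    under mates: a vertex outside it is never matched into it. *)
Lemma astem_mate M w t v : matching M -> astem M w t -> v \in w :: verts t ->
  v = tip w t \/ exists2 z, z \in w :: verts t & [set v; z] \in M.
Proof.
move=> mM st; rewrite mem_verts_cons => /orP[/(astem_even st)[|[z zt vz]]|].
- by left.
- by right; exists z; rewrite // mem_verts_cons zt orbT.
case/(astem_odd mM st) => z zt vz.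
by right; exists z; rewrite // mem_verts_cons zt.
Qed.

(** Switching the discarded part [t] frees the new tip and keeps the matching edges of [s], each of
    which has an end off [t]. *)
Lemma astem_truncate M w s t : max_matching M -> astem M w (s ++ t) ->
  exists2 M', max_matching M' & astem M' w s.
Proof.
move=> maxM st.
have [M' [max' u' _ e']] := switch maxM (astem_drop st).
exists M' => //; case/and3P: st.
rewrite apath_cat verts_cat => /andP[p _] un _; apply/and3P; split=> //; last first.
  by move: un; rewrite -cat_cons cat_uniq => /andP[].
elim: s w p un u' e' => [|[x y] s IH] w //= /and3P[wx xy p] /and3P[wn xn un] u' e'.
rewrite xy IH // !andbT e' // [tip _ _](_ : _ = tip y s) //.
have xn' : x \notin tip y s :: verts t.
  apply: contra xn; rewrite in_cons => /orP[/eqP->|xt].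
    by have := tip_mem y s; rewrite !(inE, mem_cat) => /orP[] ->; rewrite ?orbT.
  by rewrite inE mem_cat xt !orbT.
by rewrite subset_set2 (negbTE xn') andbF.
Qed.

Lemma exists_astem M w : max_matching M -> w \in GE_D G -> exists t, astem M w t.
Proof.
move=> maxM /GE_DP[N maxN uN]; have mM := max_matchingW maxM.
(* Alternate between [M] and [N] from [w]; replacing the [N]-edge [xy] by [xw]
   keeps [N] maximum and moves the vertex it misses from [w] to [y]. *)
suff [t [pt _]] : exists t, astem M w t /\
    forall v z, v \in w :: verts t -> z \in w :: verts t ->
      [set v; z] \in M -> [set v; z] \notin N
  by exists t.
have [n] := ubnP #|M :\: N|; elim: n w N maxN uN => // n IH w N maxN uN leN.
have mN := max_matchingW maxN.
have [/(saturatedP mM)[x wx]|uw] := boolP (saturated M w); last first.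
  exists [::]; split; first by apply/and3P.
  move=> v z /=; rewrite !inE => /eqP-> /eqP-> /(matching_adj mM).
  by rewrite adj_irrefl.
have wxa := matching_adj mM wx.
have [/(saturatedP mN)[y xy]|ux] := boolP (saturated N x); last first.
  by case: (max_no_edge maxN wxa).
have wxN : [set w; x] \notin N.
  by apply: contra uN => wxN; apply/(saturatedP mN); exists x.
have xwa : adj x w by rewrite adj_sym.
have [maxN' uN' eN'] := exchange maxN xy uN xwa.
set N' := _ |: _ in maxN' uN' eN'.
have xyM : [set x; y] \notin M.
  apply: contra wxN => xyM; rewrite setUC.
  by rewrite (matching_inj mM (_ : [set x; w] \in M) xyM) // setUC.
have xwN' : [set w; x] \in N' by rewrite [[set w; x]]setUC setU11.
have ltN : #|M :\: N'| < #|M :\: N|.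
  apply: proper_card; apply/properP; split.
    apply/subsetP => f; rewrite !in_setD => /andP[fN' fM]; rewrite fM andbT.
    rewrite -eN' //; first by apply: contraNneq xyM => <-.
    by apply: contraNneq fN' => ->; rewrite setU11.
  by exists [set w; x]; rewrite !in_setD ?xwN' // wxN.
have [t [st Ct]] := IH y N' maxN' uN' (leq_trans ltN leN).
have [pt un ut] := and3P st.
(* A path that met the edge [wx] would contain both its ends, being closed under mates; but [wx]
   lies in both [M] and [N'], which [Ct] excludes. *)
have main v z : [set v; z] \in M -> [set v; z] = [set w; x] -> v \notin y :: verts t.
  move=> vz E; apply/negP => vt.
  have [vtip|[z' z't vz']] := astem_mate mM st vt.
    by case/(saturatedP mM): ut; rewrite -vtip; exists z.
  have zz' := matching_inj mM vz vz'.
  by have := Ct v z vt; rewrite zz' => /(_ z't vz'); rewrite -zz' E xwN'.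
exists ((x, y) :: t); split.
  have wnt : w \notin y :: verts t by exact: main wx _.
  have xnt : x \notin y :: verts t by apply: (main x w); rewrite setUC.
  apply/and3P; split=> //=; first by rewrite wx (matching_adj mN xy).
  by rewrite inE negb_or (adj_neq wxa) wnt xnt.
move=> v z /= vt zt vzM; apply/negP => vzN.
have vzx : [set v; z] != [set w; x] by apply: contraNneq wxN => <-.
have vzy : [set v; z] != [set x; y] by apply: contraNneq xyM => <-.
have vzN' : [set v; z] \in N' by rewrite eN' // [[set x; w]]setUC.
have inner a b : a \in [:: w, x, y & verts t] -> [set a; b] \in M ->
    [set a; b] != [set w; x] -> a \in y :: verts t.
  move=> /predU1P[->|/predU1P[->|//]] ab.
    by rewrite (matching_inj mM ab wx) eqxx.
  by rewrite (matching_inj mM ab (_ : [set x; w] \in M)) 1?setUC ?eqxx // setUC.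
have zvM : [set z; v] \in M by rewrite setUC.
have zvx : [set z; v] != [set w; x] by rewrite setUC.
by have := Ct v z (inner v z vt vzM vzx) (inner z v zt zvM zvx) vzM; rewrite vzN'.
Qed.

(** Free a neighbour [d] of [a] by switching a stem from [d]. If [a] is on that stem, it is at an
    odd position and its mate at an even one. Otherwise [am] survives the switch, and exchanging it
    for [ad] frees [m]. *)
Lemma A_mate M a m : max_matching M -> a \in GE_A G -> [set a; m] \in M -> m \in GE_D G.
Proof.
move=> maxM; rewrite inE => /andP[aD /existsP[d /andP[dD ad]]] am.
have mM := max_matchingW maxM.
have [t st] : exists t, astem M d t by exact: exists_astem.
have [M' [max' u' p' e']] := switch maxM st.
have [ast|ant] := boolP (a \in d :: verts t).
  have : a \in unzip1 t.
    apply: contraNT aD => na; apply: astem_even_D (maxM) (st) _.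
    by move: ast; rewrite !inE mem_verts (negbTE na).
  case/(astem_odd mM st) => z zt /(matching_inj mM am) ->.
  exact: astem_even_D maxM st zt.
have am' : [set a; m] \in M' by rewrite e' // subset_set2 (negbTE ant).
have [M2 u2 _] := exchange max' am' u' ad.
by apply/GE_DP; exists ([set a; d] |: (M' :\ [set a; m])).
Qed.

(* Each exchange along the path moves the unsaturated vertex from [z] to the first
   odd vertex, which then plays the role of [z] for the rest of the path. *)
Lemma odds_D M u z t : max_matching M -> ~~ saturated M z -> adj u z ->
  apath M u t -> uniq (u :: verts t) -> {subset unzip1 t <= GE_D G}.
Proof.
elim: t M u z => [|[x y] t IH] M u z maxM uz auz //= /and3P[ux xy pt] /and3P[un xn unt].
have [max1 u1 e1] := exchange maxM ux uz auz.
move=> v /predU1P[->|].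
  by apply/GE_DP; exists ([set u; z] |: (M :\ [set u; x])).
have ayx : adj y x by rewrite adj_sym.
have un' : u \notin y :: verts t.
  by apply: contra un; rewrite !(inE, in_cons) => ->; rewrite orbT.
apply: (IH _ y x max1 u1 ayx _ unt); apply: apath_eq pt => f fM fs.
rewrite e1 //; apply: contraTneq fs => ->; rewrite subset_set2 (negbTE un') //.
Qed.

Definition D_nbr r := exists2 u, u \in GE_D G & adj r u.

(** Being unsaturated, [r] can only be on a stem as its tip. A stem from [u] that avoids [r] could
    be switched, leaving both ends of the edge [ru] free, against maximality. *)
Lemma D_nbr_stem M r u : max_matching M -> ~~ saturated M r -> u \in GE_D G -> adj r u ->
  exists2 t, astem M u t & tip u t = r.
Proof.
move=> maxM ur uD ru; have mM := max_matchingW maxM.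
have [t st] := exists_astem maxM uD; exists t => //; apply/eqP; apply: contraT => ne.
have rt : r \notin u :: verts t.
  apply: contra ne => /(astem_mate mM st)[->//|[z _ rz]].
  by case/(saturatedP mM): ur; exists z.
have [M' [max' u' _ e']] := switch maxM st; have mM' := max_matchingW max'.
case: (max_no_edge max' ru _ u'); apply: contra ur => /(saturatedP mM')[z rz].
by apply/(saturatedP mM); exists z; rewrite -e' // subset_set2 (negbTE rt).
Qed.

(** * Translation between lists of pairs and the paths and cycles of the definitions *)

Lemma apath_path M w t : matching M -> apath M w t -> path (@adj G) w (verts t).
Proof.
move=> mM; elim: t w => [|[x y] t IH] w //= /and3P[wx -> /IH->].
by rewrite (matching_adj mM wx).
Qed.

Lemma cycle_edges_cons u (s : seq G) : uniq (u :: s) ->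
  cycle_edges (u :: s) = path_edges u (rcons s u).
Proof.
move=> un; apply: (@eq_from_nth _ set0); first by rewrite size_map size_pairmap size_rcons.
rewrite size_map => i li; rewrite (nth_map u) // (nth_pairmap u) ?size_rcons //.
rewrite next_nth mem_nth // index_uniq // -rcons_cons !nth_rcons li.
(* At the last index, the successor [u] on the cycle is the default value of [nth]. *)
by rewrite /= ltnS in li; case: ltngtP li => // -> _; rewrite (nth_default u (leqnn (size s))).
Qed.

Lemma path_edges_rcons x (s : seq G) z :
  path_edges x (rcons s z) = rcons (path_edges x s) [set last x s; z].
Proof. by elim: s x => [|y s IH] x //=; rewrite -IH. Qed.

Lemma path_edges_next M x y z : matching M -> x != z ->
  [set x; y] \in M -> [set y; z] \notin M.
Proof.
move=> mM xz xy; apply: contra xz => yz; apply/eqP.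
by apply: (matching_inj mM _ yz); rewrite setUC.
Qed.

Lemma count_apath M w t : matching M -> apath M w t -> uniq (w :: verts t) ->
  count (fun f => f \in M) (path_edges w (verts t)) = size t.
Proof.
move=> mM; elim: t w => [|[x y] t IH] w //= /and3P[wx xy pt] /and3P[wn xn un].
have wy : w != y by apply: contraNneq wn => ->; rewrite !inE eqxx orbT.
by rewrite -/(path_edges _ _) IH // wx (negbTE (path_edges_next mM wy wx)).
Qed.

Definition xorM M f e := (f \in M) (+) (e \in M).

Lemma apath_sorted M w t : matching M -> apath M w t -> uniq (w :: verts t) ->
  sorted (xorM M) (path_edges w (verts t)).
Proof.
move=> mM pt un.
(* As [set0] is not an edge, it acts as a fictitious edge outside [M] before the first one, which
   makes the induction uniform. *)
suff: path (xorM M) set0 (path_edges w (verts t)) by exact: path_sorted.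
have : set0 \notin M.
  apply/negP => fM; have := mM => /andP[/subsetP/(_ _ fM)/edgesP[x [y [_ /setP/(_ x)]]]].
  by rewrite !inE eqxx.
elim: t w set0 pt un => [|[x y] t IH] w f //= /and3P[wx xy pt] /and3P[wn xn un] nf.
have wy : w != y by apply: contraNneq wn => ->; rewrite !inE eqxx orbT.
have nxy := path_edges_next mM wy wx.
by rewrite -/(path_edges _ _) IH // /xorM wx (negbTE nf) (negbTE nxy).
Qed.

Lemma astem_stem M w t : matching M -> astem M w t -> stem M w (verts t).
Proof.
move=> mM /and3P[pt un ut]; rewrite /stem /altpath /gpath un (apath_path mM pt) /=.
by rewrite (apath_sorted mM pt un) size_verts odd_double last_verts.
Qed.

Lemma last_xorM M f (l : seq {set G}) : path (xorM M) f l ->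
  (last f l \in M) = (f \in M) (+) odd (size l).
Proof.
elim: l f => [|e l IH] f /=; first by rewrite addbF.
case/andP=> fe /IH->; rewrite -addTb -fe /xorM.
by case: (f \in M); case: (e \in M); case: odd.
Qed.

Lemma alt_apath M w (s : seq G) : ~~ odd (size s) -> path (@adj G) w s ->
  sorted (xorM M) (path_edges w s) -> (s == [::]) || (head set0 (path_edges w s) \in M) ->
  exists2 t, s = verts t & apath M w t.
Proof.
have [n] := ubnP (size s); elim: n s w => // n IH [|x [|y s]] w //= lt.
  by exists [::].
rewrite negbK => ev /and3P[wx xy ys] /andP[a1 a2] wxM.
have xyM : [set x; y] \notin M by move: a1; rewrite /xorM wxM.
have ls : size s < n by lia.
have hs : (s == [::]) || (head set0 (path_edges y s) \in M).
  case: s a2 {lt ev ys ls} => [|z s] //= /andP[]; rewrite /xorM (negbTE xyM).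
  by case: (_ \in M).
have [t -> pt] := IH s y ls ev ys (path_sorted a2) hs.
by exists ((x, y) :: t) => //=; rewrite wxM xy.
Qed.

(** The last edge is outside [M], as it ends at an unsaturated vertex; the length being even,
    alternation puts the first edge in [M]. *)
Lemma stem_astem M w (s : seq G) : matching M -> stem M w s ->
  exists2 t, s = verts t & astem M w t.
Proof.
move=> mM /and3P[/andP[/andP[pw un] so] ev us].
have [t st pt] : exists2 t, s = verts t & apath M w t.
  apply: alt_apath => //.
  case/lastP: s pw un so ev us => [|s z] // _ _ so ev us.
  have : last set0 (path_edges w (rcons s z)) \notin M.
    rewrite path_edges_rcons last_rcons; apply: contra us => E.
    by rewrite last_rcons; apply/(saturatedP mM); exists (last w s); rewrite setUC.
  have : size (path_edges w (rcons s z)) = size (rcons s z) by rewrite size_pairmap.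
  case: (path_edges _ _) so => [|f l] /=; first by rewrite size_rcons.
  move=> /last_xorM-> El; move: ev; rewrite -El /= negbK => ->.
  by rewrite addbT negbK => ->; rewrite orbT.
by exists t; rewrite // /astem pt -st un -last_verts -st.
Qed.

(** With both end edges in [M] the length is odd; splitting off the last vertex [z] leaves an even
    path that lists of pairs can encode. *)
Lemma mm_path_apath M b (p : seq G) : matching M -> mm_path M b p ->
  exists t z, [/\ p = rcons (verts t) z, apath M b t, uniq (b :: verts t) &
                [set tip b t; z] \in M].
Proof.
move=> mM /and4P[/andP[/andP[pb un] so]].
case/lastP: p pb un so => // p z.
rewrite rcons_path -rcons_cons rcons_uniq => /andP[pb _] /andP[_ un].
rewrite path_edges_rcons last_rcons => so _ hM lM.
have ev : ~~ odd (size p).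
  move: so hM lM; have : size (path_edges b p) = size p by rewrite size_pairmap.
  case: (path_edges b p) => [<-//|f l] /= <-.
  rewrite -cats1 => /last_xorM; rewrite last_cat size_cat /= => -> ->.
  by rewrite addn1 /= => /negbTE; case: odd.
have sp : sorted (xorM M) (path_edges b p) by move: so; rewrite -cats1 => /cat_sorted2[].
have [|t pE pt] := alt_apath ev pb sp.
  by case: p hM {pb un so lM ev sp} => [|x p].
by exists t, z; rewrite -last_verts -pE.
Qed.

(** * Blossoms and the flowers built on them *)

(** A blossom cut open at its base [r]: the path goes from a neighbour [u] of [r] once around the
    cycle to [r], and the edge [ru] closes it. *)
Definition rooted_blossom M u t r :=
  [/\ apath M u t, uniq (u :: verts t), tip u t = r & adj r u].

Lemma rooted_blossom_blossom M u t r : matching M -> ~~ saturated M r ->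
  rooted_blossom M u t r -> blossom M (u :: verts t) /\ base M (u :: verts t) r.
Proof.
move=> mM ur [pt un tr ru].
have t0 : t != [::] by apply: contraTneq ru => t0; rewrite -tr t0 adj_irrefl.
have rc f : r \in f -> f \notin M.
  by move=> rf; apply: contra ur => fM; apply/bigcupP; exists f.
split; last first.
  apply/andP; split; first by rewrite -tr tip_mem.
  by apply/allP => f _; apply/implyP; apply: contraTN => /rc.
apply/and3P; split.
- apply/and3P; split=> //; first by case: (t) t0 => [|[]].
  by rewrite /= rcons_path last_verts tr ru andbT; exact: apath_path pt.
- by rewrite /= size_verts odd_double.
rewrite cycle_edges_cons // path_edges_rcons -cats1 count_cat count_apath //=.
rewrite size_verts last_verts tr (negbTE (rc _ _)) ?set21 //.
by rewrite !addn0 /= uphalf_double.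
Qed.

Lemma count_path_edges M w (l : seq G) : matching M -> uniq (w :: l) ->
  count (fun f => f \in M) (path_edges w l) <= uphalf (size l).
Proof.
move=> mM; have [n] := ubnP (size l); elim: n l w => // n IH [|x [|y l]] w //=.
  by case: (_ \in M).
rewrite -/(path_edges _ _) => lt /and3P[wn xn un].
have lel : size l < n by lia.
have wy : w != y by apply: contraNneq wn => ->; rewrite !inE eqxx orbT.
have := IH l y lel un; have := path_edges_next mM wy (y := x).
case: (_ \in M) => [/(_ isT)/negbTE->|_]; first by rewrite /= => le; apply: le.
by case: (_ \in M) => /=; lia.
Qed.

(** The number of edges is odd and the count is the largest possible, so the first edge is in [M]:
    otherwise the remaining edges, even in number, could supply only half of their number. *)
Lemma count_path_edges_apath M w (l : seq G) b : matching M -> uniq (w :: l) ->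
  path (@adj G) w (rcons l b) -> odd (size l) ->
  uphalf (size l) <= count (fun f => f \in M) (path_edges w l) ->
  exists2 t, rcons l b = verts t & apath M w t.
Proof.
move=> mM; have [n] := ubnP (size l); elim: n l w => // n IH [|x [|y l]] w //=.
  move=> _ _ /and3P[wx xb _] _; case wxM: (_ \in M) => // _.
  by exists [:: (x, b)] => //=; rewrite wxM xb.
rewrite -/(path_edges _ _) => lt /and3P[wn xn un] /and3P[wx xy yl]; rewrite negbK => ol.
have lel : size l < n by lia.
have wy : w != y by apply: contraNneq wn => ->; rewrite !inE eqxx orbT.
have [wxM|nwx] := boolP (_ \in M).
  rewrite (negbTE (path_edges_next mM wy wxM)) !add0n add1n ltnS => le.
  have [t -> pt] := IH l y lel un yl ol le.
  by exists ((x, y) :: t); rewrite //= wxM xy.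
have /= := @count_path_edges M x (y :: l) mM _.
rewrite -/(path_edges _ _) xn un => /(_ isT) le1 le2.
have := leq_trans le2 le1; rewrite -[in X in _ <= X](odd_double_half (size l)) ol.
by have := odd_double_half (size l); rewrite ol uphalf_half ol; lia.
Qed.

Lemma cycle_edges_rot n (c : seq G) : uniq c -> cycle_edges (rot n c) = rot n (cycle_edges c).
Proof.
by move=> un; rewrite /cycle_edges -map_rot; apply: eq_map => x; rewrite next_rot.
Qed.

(** In a blossom of length 2k+1, the two edges at the base are outside [M], so the k matching edges
    lie among the 2k-1 edges of the path on the other vertices, which must then alternate. *)
Lemma blossom_rooted M (c : seq G) b : matching M -> blossom M c -> base M c b ->
  exists u t, rooted_blossom M u t b /\ u :: verts t =i c.
Proof.
move=> mM /and3P[/and3P[c2 cc un] oc /eqP cM] /andP[bc /allP bM].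
case/rot_to: (bc) => i s E.
have cE : cycle_edges (rot i c) = rot i (cycle_edges c) by exact: cycle_edges_rot.
have un' : uniq (b :: s) by rewrite -E rot_uniq.
have cc' : cycle (@adj G) (b :: s) by rewrite -E rot_cycle.
have sc : size c = (size s).+1 by rewrite -(size_rot i) E.
have bM' f : f \in cycle_edges (b :: s) -> b \in f -> f \notin M.
  rewrite -E cE mem_rot => /bM /implyP fb bf; apply/negP => /fb.
  by rewrite bf.
have cM' : count (fun f => f \in M) (cycle_edges (b :: s)) = (size s).+1./2.
  by rewrite -E cE -sc -cM; apply/permP; rewrite perm_rot.
move: bM' cM'; rewrite cycle_edges_cons //.
have mem_c : b :: s =i c by move=> z; rewrite -E mem_rot.
rewrite sc in c2 oc; case: s un' cc' mem_c {E cE sc} c2 oc => // u s.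
rewrite /= negbK => /andP[bn un'] /andP[bu us] mem_c _ os bM'.
rewrite -/(path_edges _ _) path_edges_rcons -cats1 count_cat /=.
rewrite (negbTE (bM' [set b; u] _ _)) ?inE ?eqxx //.
rewrite (negbTE (bM' [set last u s; b] _ _)) ?set22 //; last first.
  by rewrite in_cons -/(path_edges _ _) path_edges_rcons mem_rcons inE eqxx orbT.
rewrite add0n !addn0 => ct.
have [|t st pt] := count_path_edges_apath mM un' us os.
  by rewrite -/(path_edges _ _) ct uphalf_half; lia.
exists u, t; split; last by move=> z; rewrite -mem_c -st !inE mem_rcons inE orbCA.
rewrite /rooted_blossom -last_verts -st last_rcons; split=> //.
by rewrite -rcons_cons rcons_uniq bn.
Qed.

Lemma leq_size_uniq (s : seq G) : uniq s -> size s <= #|G|.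
Proof. by move/card_uniqP <-; exact: max_card. Qed.

Lemma Tflower_Flower M (c : seq G) b (s : seq G) v : max_matching M -> Tflower M c b s ->
  (v \in c) || (v \in b :: s) -> v \in Flower G.
Proof.
move=> maxM fl vin.
have [/and3P[/and3P[_ _ uc] _ _] _ /and3P[/andP[/andP[_ us] _] _ _] _] := and4P fl.
rewrite inE; apply/existsP; exists M; rewrite maxM /=.
have ss : size s <= #|G| by have := leq_size_uniq us; apply: ltnW.
by apply/existsP; exists (Bseq (leq_size_uniq uc)); apply/existsP; exists b;
   apply/existsP; exists (Bseq ss); rewrite fl.
Qed.

(** Vertices at even positions are freed by switching; those at odd positions by first bringing the
    closing edge [ru] into the matching. *)
Lemma rooted_blossom_D M u t r : max_matching M -> ~~ saturated M r ->
  rooted_blossom M u t r -> {subset u :: verts t <= GE_D G}.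
Proof.
move=> maxM ur [pt un tr ru] v vt.
have [vo|nvo] := boolP (v \in unzip1 t).
  by apply: (odds_D maxM ur _ pt un) => //; rewrite adj_sym.
apply: (@astem_even_D M u t) => //; first by rewrite /astem pt un tr.
by move: vt; rewrite !inE mem_verts (negbTE nvo).
Qed.

(** Under [M] the base [r] is itself unsaturated. Switching the stem moves the free vertex to [w]
    and leaves the blossom as it was, since they share only [r]; the reversed stem then runs from
    [r] to [w]. *)
Lemma rooted_blossom_Flower M w s u t r : max_matching M -> astem M w s -> tip w s = r ->
  rooted_blossom M u t r ->
  (forall y, y \in u :: verts t -> y \in w :: verts s -> y = r) ->
  {subset w :: verts s <= Flower G}.
Proof.
move=> maxM st tr rb dis v vs; have mM := max_matchingW maxM.
have [/= pt unt trt ru] := rb.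
have ur : ~~ saturated M r by case/and3P: st => _ _; rewrite tr.
have [M' [max' u' p' e']] := switch maxM st.
have mM' := max_matchingW max'.
have rs : r \in w :: verts s by rewrite -tr tip_mem.
have [bl bs] := rooted_blossom_blossom mM ur rb.
have cE f : f \in cycle_edges (u :: verts t) -> (f \in M') = (f \in M).
  have [/and3P[_ cc _] _ _] := and3P bl.
  case/mapP=> x xc ->; apply: e'; rewrite subset_set2; apply/negP => /andP[xs nxs].
  have xr := dis x xc xs; have nr : next (u :: verts t) x = r.
    by apply: dis nxs; rewrite mem_next.
  by have := next_cycle cc xc; rewrite nr xr adj_irrefl.
apply: (@Tflower_Flower M' (u :: verts t) r (verts (rev_stem w s))) => //; last first.
  by rewrite -tr verts_rev_stem mem_rev vs orbT.
apply/and4P; split.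
- case/and3P: bl => g o /eqP E; apply/and3P; split=> //; rewrite -E; apply/eqP.
  by apply: eq_in_count => f /cE.
- case/andP: bs => rc /allP al; rewrite /base rc; apply/allP => f fc.
  by rewrite cE // al.
- apply: astem_stem => //; apply/and3P; split; rewrite -tr ?tip_rev_stem //.
  by rewrite verts_rev_stem rev_uniq; case/and3P: st.
- apply/eqP/setP => y; rewrite in_setI in_set1 !inE -in_cons -[in LHS]tr.
  rewrite -in_cons verts_rev_stem mem_rev; apply/andP/eqP => [[yc ys]|->].
    exact: dis.
  by split; rewrite // -trt tip_mem.
Qed.

Lemma D_nbr_Flower r : r \in GE_D G -> D_nbr r -> r \in Flower G.
Proof.
case/GE_DP=> M maxM ur [u uD ru].
have [t st tr] := D_nbr_stem maxM ur uD ru; have [pt un _] := and3P st.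
have st0 : astem M r [::] by apply/and3P; split.
apply: (rooted_blossom_Flower maxM st0 (erefl _) (And4 pt un tr ru)); last exact: mem_head.
by move=> y _; rewrite inE => /eqP.
Qed.

(** * Reachable vertices lie in flowers *)

Definition reach v := exists M w t,
  [/\ max_matching M, astem M w t, v \in w :: verts t & D_nbr (tip w t)].

Variant verts_spec w t v : Prop :=
  | VertEven s1 s2 of t = s1 ++ s2 & v = tip w s1
  | VertOdd s1 y s2 of t = s1 ++ (v, y) :: s2.

Lemma vertsP w t v : v \in w :: verts t -> verts_spec w t v.
Proof.
elim: t w => [|[x y] t IH] w /=.
  by rewrite inE => /eqP ->; exact: (@VertEven _ _ _ [::] [::]).
case/predU1P=> [->|/predU1P[->|/IH[s1 s2 -> vE|s1 z s2 ->]]].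
- exact: (@VertEven _ _ _ [::] ((x, y) :: t)).
- exact: (@VertOdd _ _ _ [::] y t).
- exact: (@VertEven _ _ _ ((x, y) :: s1) s2).
- exact: (@VertOdd _ _ _ ((x, y) :: s1) z s2).
Qed.

Lemma unzip1_split t x : x \in unzip1 t -> exists s1 y s2, t = s1 ++ (x, y) :: s2.
Proof.
case/mapP=> -[x' y] xt /= ->; case/splitPr: xt => s1 s2.
by exists s1, y, s2.
Qed.

(** Cutting the stem at an odd vertex of [GE_D] may discard what follows, so only the first two
    vertices are claimed; [reach_Flower] starts the stem at the given vertex or at its mate. *)
Lemma reach_head_Flower M w t : max_matching M -> astem M w t -> D_nbr (tip w t) ->
  {subset w :: take 1 (verts t) <= Flower G}.
Proof.
have [n] := ubnP (size t); elim: n t M => // n IH t M lt maxM st nb.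
have mM := max_matchingW maxM.
(* The blossom at the tip lies in [GE_D]; it can meet the stem elsewhere only if
   the stem has some odd vertex in [GE_D]. *)
have [/hasP[x /unzip1_split[s1 [y [s2 tE]]] xD]|no] := boolP (has (mem (GE_D G)) (unzip1 t)).
  have xD' : x \in GE_D G by [].
  have px : D_nbr (tip w s1).
    exists x => //; apply: (matching_adj mM).
    by case/and3P: st; rewrite tE apath_cat /= => /and4P[].
  (* If [x] is the mate of [w], both are in [GE_D] and neighbours of each other, so each is the base
     of a flower with an empty stem. *)
  case: s1 tE px => [|[a b] s1] tE px.
    rewrite tE => v /predU1P[->|].
      by apply: D_nbr_Flower px; exact: astem_D st.
    rewrite /= orbF => /eqP ->; apply: D_nbr_Flower => //.
    exists w; first exact: astem_D st.
    rewrite adj_sym; apply: (matching_adj mM).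
    by case/and3P: st; rewrite tE => /and3P[].
  rewrite tE in st lt; have [M' max' st'] := astem_truncate maxM st.
  rewrite tE /=; apply: (IH _ M' _ max' st' px).
  by move: lt; rewrite size_cat /=; lia.
case: (nb) => u uD ru.
have ur : ~~ saturated M (tip w t) by case/and3P: st.
have [s sts ts] := D_nbr_stem maxM ur uD ru.
have rb : rooted_blossom M u s (tip w t) by case/and3P: sts => p1 p2 _; split.
have bD := rooted_blossom_D maxM ur rb.
have ndt y : y \in GE_D G -> y \in unzip1 t -> False.
  by move=> yD yt; case/negP: no; apply/hasP; exists y.
(* A common vertex other than the tip would have its mate on the blossom, hence in [GE_D], and at an
   odd position of the stem. *)
have dis y : y \in u :: verts s -> y \in w :: verts t -> y = tip w t.
  move=> yc; rewrite mem_verts_cons => /orP[yt|/(ndt _ (bD _ yc))//].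
  case: (astem_even st yt) => // -[z zt yz].
  case: (astem_mate mM sts yc) => [->|[z' z's yz']]; first exact: ts.
  by case: (ndt z) => //; apply: bD; rewrite (matching_inj mM yz yz').
move=> v vt; apply: (rooted_blossom_Flower maxM st (erefl _) rb dis).
by move: vt; rewrite !in_cons => /orP[->//|/mem_take->]; rewrite orbT.
Qed.

Lemma reach_Flower v : reach v -> v \in Flower G.
Proof.
case=> M [w [t [maxM st vt nb]]]; case: (vertsP vt) => [s1 s2 tE vE|s1 y s2 tE].
  rewrite tE in st nb; rewrite tip_cat in nb.
  have sub := reach_head_Flower maxM (astem_drop st) nb.
  by apply: sub; rewrite vE mem_head.
rewrite tE in st nb; rewrite tip_cat in nb.
have sub := reach_head_Flower maxM (astem_drop st) nb.
by apply: sub; rewrite ?take0 !inE eqxx orbT.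
Qed.

(** * Reachability passes along the edges between [GE_D] and [GE_A] *)

Lemma D_nbr_reach v : v \in GE_D G -> D_nbr v -> reach v.
Proof.
case/GE_DP=> M maxM uv nb; exists M, v, [::]; split=> //; exact: mem_head.
Qed.

(** If [v] is at an odd position, the next vertex of the stem is in [GE_D], and the empty stem under
    a matching that misses [v] will do. *)
Lemma reach_D v : reach v -> v \in GE_D G ->
  exists M t, [/\ max_matching M, astem M v t & D_nbr (tip v t)].
Proof.
case=> M [w [t [maxM st vt nb]]] vD; case: (vertsP vt) => [s1 s2 tE vE|s1 y s2 tE].
  rewrite tE in st nb; rewrite tip_cat -vE in nb.
  by exists M, s2; split; rewrite // vE; exact: astem_drop st.
case/GE_DP: (vD) => N maxN uv; exists N, [::]; split=> //.
rewrite tE in st; have /and3P[/= /and3P[_ vy _] _ _] := astem_drop st.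
exists y => //; apply: (@astem_D M _ s2) => //.
by move: st; rewrite -cat_rcons => /astem_drop; rewrite /tip /unzip2 map_rcons last_rcons.
Qed.

(** If [a] is off the stem from [d], so is its mate [m], and the stem can be prefixed with [m],
    [a]. *)
Lemma reach_D_A d a : reach d -> d \in GE_D G -> a \in GE_A G -> adj d a -> reach a.
Proof.
move=> rd dD; rewrite inE => /andP[aD _] da.
have [M [t [maxM st nb]]] := reach_D rd dD; have mM := max_matchingW maxM.
have [at_|nat_] := boolP (a \in d :: verts t); first by exists M, d, t.
have /(saturatedP mM)[m am] : saturated M a.
  by apply: contraNT aD => ua; apply/GE_DP; exists M.
have ma : [set m; a] \in M by rewrite setUC.
have mt : m \notin d :: verts t.
  apply/negP => /(astem_mate mM st)[mE|[z zt mz]].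
    by case/and3P: st => _ _ /(saturatedP mM)[]; exists a; rewrite -mE.
  by rewrite (matching_inj mM ma mz) zt in nat_.
exists M, m, ((a, d) :: t); split=> //; last by rewrite !inE eqxx orbT.
have [pt un ut] := and3P st; apply/and3P; split=> //=.
  by rewrite ma adj_sym da.
by rewrite inE negb_or mt nat_ -andbA eq_sym (adj_neq (matching_adj mM am)).
Qed.

(** Both stems belong to the same [M] and are closed under mates, so the second can only enter the
    first through an edge outside [M], that is, at the second entry of a pair. *)
Lemma astem_meet M a s w t : matching M -> astem M a s -> astem M w t ->
  w \notin a :: verts s ->
  (forall v, v \in w :: verts t -> v \notin a :: verts s) \/
  exists t1 x z t2, [/\ t = t1 ++ (x, z) :: t2, z \in a :: verts s,
    x \notin a :: verts s & forall v, v \in w :: verts t1 -> v \notin a :: verts s].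
Proof.
move=> mM sts; elim: t w => [|[x z] t IH] w stt ws.
  by left=> v; rewrite mem_seq1 => /eqP->.
have [/= /and3P[wx _ _] _ _] := and3P stt.
have xw : [set x; w] \in M by rewrite setUC.
have xs : x \notin a :: verts s.
  apply: contra ws => /(astem_mate mM sts)[xE|[y ys xy]].
    by case/and3P: sts => _ _ /(saturatedP mM)[]; exists w; rewrite -xE.
  by rewrite (matching_inj mM xw xy).
have [zs|zs] := boolP (z \in a :: verts s).
  by right; exists [::], x, z, t; split=> // v; rewrite mem_seq1 => /eqP->.
case: (IH z (@astem_drop M w [:: (x, z)] t stt) zs) => [dis|[t1 [x' [z' [t2 [-> z's x's dis]]]]]].
  by left=> v /predU1P[->//|/predU1P[->//|]]; exact: dis.
right; exists ((x, z) :: t1), x', z', t2; split=> // v.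
by move=> /predU1P[->//|/predU1P[->//|]]; exact: dis.
Qed.

Lemma matching_mem M f : matching M -> f \in M -> exists x, x \in f.
Proof.
case/andP=> /subsetP sM _ /sM/edgesP[x [y [_ ->]]].
by exists x; rewrite set21.
Qed.

Lemma reach_A_D a w : reach a -> a \in GE_A G -> w \in GE_D G -> adj a w -> reach w.
Proof.
case=> M [w0 [t [maxM st vt nb]]]; rewrite inE => /andP[aD _] wD aw.
have mM := max_matchingW maxM.
(* Not being in [GE_D], [a] is at an odd position; the stem is shortened to begin at its mate
   [a']. *)
case: (vertsP vt) => [s1 s2 tE vE|s1 y s2 tE].
  by rewrite vE (astem_D maxM (_ : astem M _ s2)) // in aD; apply: astem_drop; rewrite -tE.
move: st nb; rewrite {}tE => /astem_drop; rewrite tip_cat; move: (tip w0 s1) => a' st nb.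
have [ws|ws] := boolP (w \in a' :: verts ((a, y) :: s2)).
  by exists M, a', ((a, y) :: s2).
have [q stq] := exists_astem maxM wD.
(* If the stem from [w] avoids the stem through [a], switch it and match [a] to
   [w].  Otherwise it first meets that stem in some [z] of [GE_D]: at an even
   position of that stem, follow it from [z]; at an odd one, [z] has a neighbour
   in [GE_D] and the stem from [w] can be cut at [z]. *)
have [/= /and3P[a'a ay p2] /and3P[a'n an un] ut] := and3P st.
case: (astem_meet mM st stq ws) => [dis|[q1 [x [z [q2 [qE zs xs dis]]]]]]; last first.
  have stz : astem M z q2.
    move: stq; rewrite qE -cat_rcons => /astem_drop.
    by rewrite /tip /unzip2 map_rcons last_rcons.
  case: (vertsP zs) => [s3 s4 sE zE|s3 y' s4 sE]; last first.
    move: stq; rewrite qE -cat_rcons => /(astem_truncate maxM)[M' max' st'].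
    exists M', w, (rcons q1 (x, z)); split=> //; first exact: mem_head.
    rewrite /tip /unzip2 map_rcons last_rcons; exists y'.
      apply: (@astem_D M y' s4) => //; move: st; rewrite sE -cat_rcons => /astem_drop.
      by rewrite /tip /unzip2 map_rcons last_rcons.
    by move: st; rewrite sE => /astem_drop /and3P[/= /and3P[]].
  exists M, w, (q1 ++ (x, z) :: s4).
  have tE : tip w (q1 ++ (x, z) :: s4) = tip a' ((a, y) :: s2) by rewrite sE !tip_cat -zE.
  split; rewrite ?tE ?mem_head //; apply/and3P; split; last by rewrite tE.
    move: stq => /and3P[]; rewrite qE !apath_cat /= => /and4P[-> -> -> _] _ _ /=.
    by rewrite zE; move: st; rewrite sE => /astem_drop/and3P[].
  have uz : uniq (z :: verts s4).
    by rewrite zE; move: st; rewrite sE => /astem_drop/and3P[].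
  have zsub v : v \in z :: verts s4 -> v \in a' :: verts ((a, y) :: s2).
    by rewrite in_cons => /orP[/eqP->//|vs]; rewrite sE verts_cat in_cons mem_cat vs !orbT.
  have uq : uniq ((w :: verts q1) ++ [:: x]).
    have : uniq (w :: verts q) by case/and3P: stq.
    rewrite qE verts_cat -cat_cons -[verts (_ :: q2)]/([:: x] ++ z :: verts q2).
    by rewrite catA cat_uniq => /andP[].
  rewrite verts_cat -cat_cons -[verts (_ :: s4)]/([:: x] ++ z :: verts s4) catA.
  rewrite cat_uniq uq uz andbT andTb; apply/hasPn => v /zsub vs.
  rewrite mem_cat negb_or; apply/andP; split; apply: contraL vs; first exact: dis.
  by rewrite mem_seq1 => /eqP->.
have [M1 [max1 u1 _ e1]] := switch maxM stq.
have aq : a \notin w :: verts q by apply/negP => /dis/negP[]; rewrite in_cons mem_head orbT.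
have aa'1 : [set a; a'] \in M1 by rewrite e1 ?subset_set2 ?(negbTE aq) // setUC.
have [max2 u2 e2] := exchange max1 aa'1 u1 aw.
move: max2 u2 e2; set M2 := _ |: _ => max2 u2 e2.
have mM2 := max_matchingW max2.
have e f v : v \in f -> v \in y :: verts s2 -> (f \in M2) = (f \in M).
  move=> vf vs.
  have va : v != a by apply: contraNneq an => <-.
  have va' : v != a' by apply: contraNneq a'n => <-; rewrite in_cons vs orbT.
  have vw : v != w by apply: contraNneq ws => <-; rewrite !in_cons -in_cons vs !orbT.
  rewrite e2 ?e1 //.
  - apply/negP => /subsetP/(_ v vf); rewrite inE => /dis/negP[].
    by rewrite 2!in_cons vs !orbT.
  - by apply: contraTneq vf => ->; rewrite !inE negb_or va.
  - by apply: contraTneq vf => ->; rewrite !inE negb_or va.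
exists M2, w, ((a, y) :: s2); split; rewrite ?mem_head //; apply/and3P; split=> //=.
- rewrite [[set w; a]]setUC setU11 ay /=; apply: apath_eq p2 => f fM /subsetP fs.
  have [v vf] := matching_mem mM fM.
  by rewrite (e _ v) //; have := fs _ vf; rewrite inE.
- by move: ws; rewrite in_cons negb_or => /andP[_ ->]; rewrite an.
apply: contra ut => /(saturatedP mM2)[v tv]; apply/(saturatedP mM); exists v.
by rewrite -(e _ (tip y s2)) ?set21 // tip_mem.
Qed.

(** * Unreachable vertices when [GE_C] is empty *)

Section Unreached.
Hypothesis C0 : GE_C G = set0.
Variables (M : {set {set G}}) (maxM : max_matching M).

Definition unreached_A v := v \in GE_A G /\ ~ reach v.
Definition unreached_D v := v \in GE_D G /\ ~ reach v.

Lemma GE_DA v : (v \in GE_D G) || (v \in GE_A G).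
Proof. by have /setP/(_ v) := C0; rewrite !inE => /negbFE. Qed.

Lemma unreached_disj v : unreached_A v -> unreached_D v -> False.
Proof. by case=> + _ [vD _]; rewrite inE vD. Qed.

Lemma unreached_adj x y : unreached_D x -> adj x y -> unreached_A y.
Proof.
case=> xD nx xy; have [yD|yA] := orP (GE_DA y).
  by case: nx; apply: D_nbr_reach => //; exists y.
by split=> // ry; case: nx; apply: reach_A_D ry yA xD _; rewrite adj_sym.
Qed.

Lemma unreached_mate x y : unreached_A x -> [set x; y] \in M -> unreached_D y.
Proof.
case=> xA nx xy; have yD := A_mate maxM xA xy; split=> // ry.
case: nx; apply: reach_D_A ry yD xA _.
by rewrite adj_sym (matching_adj (max_matchingW maxM) xy).
Qed.

Lemma unreached_fwd u t : apath M u t -> unreached_A u -> unreached_A (tip u t).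
Proof.
elim: t u => [|[x y] t IH] u //= /and3P[ux xy pt] uu; apply: IH => //.
exact: unreached_adj (unreached_mate uu ux) xy.
Qed.

Lemma unreached_bwd u t : apath M u t -> unreached_D (tip u t) -> unreached_D u.
Proof.
elim: t u => [|[x y] t IH] u //= /and3P[ux xy pt] /(IH y pt) uy.
by apply: (@unreached_mate x); [apply: unreached_adj uy _; rewrite adj_sym|rewrite setUC].
Qed.

(** From an even position, [GE_D] propagates back to the head and [GE_A] forward to the tip; from an
    odd position the two directions are swapped. *)
Lemma unreached_apath u t v : apath M u t -> v \in u :: verts t -> ~ reach v ->
  unreached_D u \/ unreached_A (tip u t).
Proof.
move=> pt vt nv; case: (vertsP vt) pt => [s1 s2 -> vE|s1 y s2 ->].
  rewrite apath_cat tip_cat -vE => /andP[p1 p2].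
  have [vD|vA] := orP (GE_DA v); last by right; apply: unreached_fwd p2 _.
  by left; apply: unreached_bwd p1 _; rewrite -vE.
rewrite apath_cat tip_cat /= => /and4P[p1 uv vy p2].
have [vD|vA] := orP (GE_DA v).
  by right; apply: unreached_fwd p2 _; apply: unreached_adj vy.
by left; apply: unreached_bwd p1 _; apply: (@unreached_mate v); rewrite // setUC.
Qed.

(** Cut open at the base, the blossom is a path whose tip is the base and whose head is adjacent to
    it; either outcome of [unreached_apath] puts the base in [GE_A]. *)
Lemma unreached_blossom (c : seq G) b v : blossom M c -> base M c b -> v \in c -> ~ reach v ->
  unreached_A b.
Proof.
move=> bc bb vc nv.
have [u [t [[pt _ <- ru] mem]]] := blossom_rooted (max_matchingW maxM) bc bb.
case: (unreached_apath pt _ nv) => [|/unreached_adj|//]; first by rewrite mem.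
by apply; rewrite adj_sym.
Qed.

Lemma unreached_base (c : seq G) b : blossom M c -> base M c b -> unreached_D b -> False.
Proof.
move=> bc bb ub; apply: (unreached_disj _ ub); case: ub => _.
by apply: (unreached_blossom bc bb _); case/andP: bb.
Qed.

Lemma unreached_Tposy (c1 c2 : seq G) b (p : seq G) v : Tposy M c1 c2 b p ->
  [|| v \in c1, v \in c2 | v \in b :: p] -> ~ reach v -> False.
Proof.
case/and5P=> B1 B2 mmp b1 /and3P[b2 _ _] vin nv.
have [t [z [pE pt un tz]]] := mm_path_apath (max_matchingW maxM) mmp.
have zt : [set z; tip b t] \in M by rewrite setUC.
rewrite {}pE last_rcons in b2 vin.
(* A base in [GE_A] forces, along the joining path, the other base into [GE_D], which
   [unreached_base] forbids. *)
have noA1 : unreached_A b -> False.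
  by move/(unreached_fwd pt)/unreached_mate/(_ tz); exact: unreached_base b2.
have noA2 : unreached_A z -> False.
  by move/unreached_mate/(_ zt)/(unreached_bwd pt); exact: unreached_base b1.
case/or3P: vin => [vc|vc|].
- exact/noA1/(unreached_blossom B1 b1 vc nv).
- exact/noA2/(unreached_blossom B2 b2 vc nv).
rewrite -rcons_cons mem_rcons in_cons => /orP[/eqP vz|vt].
  rewrite vz in nv; have [zD|zA] := orP (GE_DA z); last exact: noA2.
  by apply: (unreached_base B2 b2).
case: (unreached_apath pt vt nv) => [|/unreached_mate/(_ tz)].
  exact: unreached_base b1.
exact: unreached_base b2.
Qed.

End Unreached.

(** Even stem vertices are in [GE_D] and odd ones are adjacent to them. Switching the stem frees the
    base and keeps the blossom, which then lies in [GE_D]. *)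
Lemma Flower_DA v : v \in Flower G -> (v \in GE_D G) || (v \in GE_A G).
Proof.
have nbr y x : y \in GE_D G -> adj x y -> (x \in GE_D G) || (x \in GE_A G).
  move=> yD xy; rewrite [x \in GE_A G]inE; case: (x \in GE_D G) => //=.
  by apply/existsP; exists y; rewrite yD.
rewrite inE => /existsP[M /andP[maxM]].
have mM := max_matchingW maxM.
case/existsP=> c /existsP[b /existsP[s /andP[]]].
move: (s : seq G) (c : seq G) => {}s {}c /and4P[bl bs st /eqP/setP dis].
have [t tE stt] := stem_astem mM st; rewrite {}tE in dis *.
case/orP=> [vc|vt]; last first.
  case: (vertsP vt) => [s1 s2 E vE|s1 y s2 E]; rewrite {}E in stt.
    by rewrite vE (astem_D maxM (astem_drop stt)).
  have /and3P[/= /and3P[_ vy _] _ _] := astem_drop stt.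
  apply: nbr vy; apply: (@astem_D M _ s2) => //; move: stt; rewrite -cat_rcons => /astem_drop.
  by rewrite /tip /unzip2 map_rcons last_rcons.
have [u [q [[pq un tq bu] mem]]] := blossom_rooted mM bl bs.
have [M' [max' u' _ e']] := switch maxM stt.
have rb : rooted_blossom M' u q b.
  split=> //; apply: apath_eq pq => f fM fq; rewrite e' //.
  apply/negP => ft; have : f \subset [set b].
    apply/subsetP => x xf; rewrite -dis !inE -in_cons.
    have := subsetP fq x xf; have := subsetP ft x xf.
    by rewrite inE => -> ; rewrite inE mem => ->.
  case/andP: mM => /subsetP/(_ f fM)/edgesP[x [y [xy ->]]] _.
  rewrite subUset !sub1set !inE => /andP[/eqP xb /eqP yb].
  by rewrite xb yb adj_irrefl in xy.
by rewrite (rooted_blossom_D max' u' rb) // mem.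
Qed.

End Stems.

Theorem theorem3p11 (G : sgraph) :
  (Sterboul_Deming G /\ GE_C G = set0) <-> [set: G] = Flower G.
Proof.
split=> [[SD0 C0]|FT].
  apply/esym/setP => v; rewrite in_setT; apply: contraT => vF.
  have : v \in SD G by have /setP/(_ v) := SD0; rewrite !inE => /negbFE.
  rewrite inE => /existsP[M /andP[maxM /orP[vfl|]]].
    by case/negP: vF; rewrite inE; apply/existsP; exists M; rewrite maxM.
  case/existsP=> c1 /existsP[c2 /existsP[b /existsP[p /andP[Tp vin]]]].
  case: (unreached_Tposy C0 maxM Tp vin).
  by move/reach_Flower; exact/negP.
split; apply/setP => v; have vF : v \in Flower G by rewrite -FT inE.
  rewrite !in_set0 in_setC; apply/negbF; move: vF; rewrite !inE.
  by case/existsP=> M /andP[maxM fl]; apply/existsP; exists M; rewrite maxM fl.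
by rewrite in_set0 in_setC in_setU (Flower_DA vF).
Qed.
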